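(* Let $G$ be a finite nilpotent group and $H$ an arbitrary finite group. Then $\mathrm{Pow}(G)\cong \mathrm{Pow}(H)$ if and only if $H$ is nilpotent and, for every prime $p$, $\mathrm{Pow}(G_p)\cong \mathrm{Pow}(H_p)$, where $G_p$ and $H_p$ denote the Sylow $p$-subgroups of $G$ and $H$, respectively.
   Context: All groups are finite. For a group $X$, the (undirected) power graph $\mathrm{Pow}(X)$ is the simple graph with vertex set $X$ in which two distinct vertices $x,y$ are adjacent if and only if $y\in\langle x\rangle$ or $x\in\langle y\rangle$. *)

(* Defs.v *)
From mathcomp Require Import all_boot all_fingroup all_solvable.
Set Implicit Arguments.
Unset Strict Implicit.
Unset Printing Implicit Defensive.
Local Open Scope group_scope.

Definition pow_adj (gT : finGroupType) (x y : gT) : bool :=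
  (x != y) && ((y \in <[x]>) || (x \in <[y]>)).

Definition pow_graph_iso (gT hT : finGroupType) (G : {set gT}) (H : {set hT}) : Prop :=
  exists f : gT -> hT,
    [/\ {in G &, injective f}, f @: G = H &
        {in G &, forall x y, pow_adj (f x) (f y) = pow_adj x y}].

(* Main.v *)
Require Import Defs.
From mathcomp Require Import all_boot all_fingroup all_solvable.
Set Implicit Arguments.
Unset Strict Implicit.
Unset Printing Implicit Defensive.
Local Open Scope group_scope.

(* The heart of the matter is Cameron's theorem that an isomorphism of power
   graphs can be replaced by one preserving element orders, hence preserving
   the relation y \in <[x]>; then the p-elements of G and of H correspond, and
   nilpotency says that they number #|G|`_p for every p.  Conversely, in
   nilpotent groups y \in <[x]> can be tested on p-constituents, so that
   order-preserving isomorphisms of the Sylow subgroups can be multiplied.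

   For Cameron's theorem, call x and y twins if their closed neighbourhoods
   agree.  Any bijection permuting vertices within twin classes is harmless, so
   it is enough that the graph determines how many elements of each order every
   twin class contains.
   - Dominating vertices: they form a cyclic subgroup, unless the group is
     cyclic of non prime power order; which case occurs is visible from their
     number and the order of the group.
   - Other classes: if t is an element of largest order in the class, the class
     consists of the y in <[t]> of order at least some bound, so only #[t] has
     to be recovered.  Now <[t]> consists of the dominating vertices, the class
     itself, and the neighbours below it.  Passing from x to a non-twin y with
     x \in <[y]> does not decrease the size of the twin class, and leaves it
     unchanged only if #[x] is odd and #[y] = 2 #[x]; hence class sizes tell the
     neighbours below t from those above, up to a tie that a parity argument
     resolves. *)

Implicit Types gT hT : finGroupType.

(** * Euler's totient along divisibility *)

Lemma totient_mul_prime (m p : nat) : prime p -> 0 < m ->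
  totient (m * p) = (if p %| m then p * totient m else p.-1 * totient m)%N.
Proof.
move=> pp m0; have [k cpk defm] := pfactor_coprime pp m0.
have cok e : coprime k (p ^ e) by rewrite coprime_sym coprimeXl.
case: ifP => pm; last first.
  rewrite mulnC totient_coprime; last by rewrite prime_coprime ?pm.
  by rewrite totient_prime.
have e0 : 0 < logn p m by rewrite -pfactor_dvdn.
rewrite defm -mulnA -expnSr !totient_coprime // !totient_pfactor //=.
by case: (logn p m) e0 => // e _ /=; rewrite expnS [(p.-1 * (p * _))%N]mulnCA mulnCA.
Qed.

Lemma dvdn_leq_totient (m n : nat) : m %| n -> 0 < n -> totient m <= totient n.
Proof.
case/dvdnP=> k ->; have [r] := ubnP k; elim: r m k => // r IH m k ltkr km0.
have [k1|k_gt1] := leqP k 1; first by case: k k1 km0 {ltkr} => [|[|k]] //; rewrite mul1n.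
have pp := pdiv_prime k_gt1; have /dvdnP[j kE] := pdiv_dvd k.
set p := pdiv k in pp kE *.
have p1 := prime_gt1 pp.
have j0 : 0 < j by move: km0; rewrite kE; case: j {kE}.
have m0 : 0 < m by move: km0; case: m; rewrite ?muln0.
apply: (@leq_trans (totient (m * p))).
  by rewrite totient_mul_prime //; case: ifP => _; rewrite leq_pmull // -?subn1 ?subn_gt0 // prime_gt0.
have -> : (k * m = j * (m * p))%N by rewrite kE -mulnA (mulnC p).
apply: IH; last by rewrite !muln_gt0 j0 m0 prime_gt0.
by rewrite ltnS in ltkr; apply: leq_trans _ ltkr; rewrite kE ltn_Pmulr.
Qed.

(** Multiplying [d] by a prime [p] multiplies the totient by [p] or [p - 1], so the totient can stay
    constant only for [p = 2] and [d] odd, hence only once. This is the source of the ties between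
    class sizes. *)
Lemma dvdn_eq_totient (m n : nat) : m %| n -> 0 < n -> m != n ->
  totient m = totient n -> odd m /\ n = m.*2.
Proof.
case/dvdnP=> k -> km0 nmn.
have m0 : 0 < m by move: km0; case: m {nmn}; rewrite ?muln0.
have step p d : prime p -> 0 < d -> p * d %| k * m -> m %| d ->
    totient m = totient (k * m) -> p = 2 /\ odd d.
  move=> pp d0 dvd md eqt; have p1 := prime_gt1 pp.
  have := dvdn_leq_totient dvd km0; rewrite -eqt mulnC totient_mul_prime //.
  have dpos : 0 < totient d by rewrite totient_gt0.
  have := dvdn_leq_totient md d0.
  case: ifP => pd h1 h2; move: (leq_trans h2 h1);
    rewrite -{2}[totient d]mul1n leq_pmul2r //; first by rewrite leqNgt p1.
  rewrite -ltnS prednK ?prime_gt0 // => p_le2.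
  have p2 : p = 2 by apply/eqP; rewrite eqn_leq p_le2.
  by split=> //; move: pd; rewrite p2 dvdn2 => /negbFE.
have k_gt1 : 1 < k by move: nmn km0; case: k {step} => [|[|k]] //; rewrite mul1n eqxx.
have pp := pdiv_prime k_gt1; have /dvdnP[j kE] := pdiv_dvd k.
move=> eqt; have [|p2 om] := step (pdiv k) m pp m0 _ (dvdnn m) eqt.
  by rewrite dvdn_pmul2r // pdiv_dvd.
split=> //; rewrite p2 in kE; suff j1 : j = 1%N by rewrite kE j1 mul1n mul2n.
(* A further prime factor of [j] would be applied to [2 * m], which would then have to be odd. *)
apply/eqP; apply/negPn/negP => j1.
have j0 : 0 < j by move: km0; rewrite kE; case: j {kE j1}.
have j_gt1 : 1 < j by case: j j0 j1 {kE} => [|[|]].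
have qq := pdiv_prime j_gt1.
have d0 : 0 < 2 * m by rewrite muln_gt0.
have dvd : pdiv j * (2 * m) %| k * m.
  by rewrite kE mulnA dvdn_pmul2r // dvdn_pmul2r // pdiv_dvd.
have [_] := step (pdiv j) (2 * m)%N qq d0 dvd (dvdn_mull _ (dvdnn m)) eqt.
by rewrite oddM.
Qed.

(** An odd prime factor [p] contributes the even factor [p - 1]. *)
Lemma totient_odd_even (m : nat) : odd m -> 1 < m -> ~~ odd (totient m).
Proof.
move=> om m1; have pp := pdiv_prime m1; set p := pdiv m in pp *.
have m0 : 0 < m by apply: ltnW.
have pm : p %| m := pdiv_dvd m.
have op : odd p := dvdn_odd pm om.
have [k cpk ->] := pfactor_coprime pp m0.
rewrite totient_coprime 1?coprime_sym ?coprimeXl //.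
rewrite totient_pfactor -?pfactor_dvdn // !oddM -subn1 oddB ?prime_gt0 //.
by rewrite op andbF.
Qed.

(** * Cyclic subgroups and constituents *)

Lemma mem_cycle_dvdn gT (x y z : gT) : y \in <[x]> -> z \in <[x]> ->
  (y \in <[z]>) = (#[y] %| #[z]).
Proof.
by move=> yx zx; rewrite -cycle_subG -(cardSg_cyclic (cycle_cyclic x)) ?cycle_subG.
Qed.

Lemma eq_cycle_order gT (x y z : gT) : y \in <[x]> -> z \in <[x]> ->
  (<[y]> == <[z]>) = (#[y] == #[z]).
Proof.
by move=> yx zx; rewrite (eq_subG_cyclic (cycle_cyclic x)) ?cycle_subG.
Qed.

Lemma mem_cycle_trans gT (x y z : gT) : x \in <[y]> -> y \in <[z]> -> x \in <[z]>.
Proof. by rewrite -!cycle_subG => /subset_trans; apply. Qed.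

Lemma order_mem_leq gT (x y : gT) : x \in <[y]> -> #[x] <= #[y].
Proof. by rewrite -cycle_subG => /subset_leq_card. Qed.

Lemma mem_cycle_geq gT (x y : gT) : x \in <[y]> -> #[y] <= #[x] -> <[x]> = <[y]>.
Proof.
by move=> xy le; apply/eqP; rewrite eqEcard cycle_subG xy.
Qed.

Lemma p_elt_cycle_chain gT (p : nat) (x y z : gT) : p.-elt x -> y \in <[x]> ->
  z \in <[x]> -> (y \in <[z]>) || (z \in <[y]>).
Proof.
move=> px yx zx; rewrite !(mem_cycle_dvdn _ zx) ?(mem_cycle_dvdn _ yx) //.
have [m ->] := p_natP (mem_p_elt px yx); have [n ->] := p_natP (mem_p_elt px zx).
by case/orP: (leq_total m n) => le; rewrite !(dvdn_exp2l _ le) ?orbT.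
Qed.

Lemma constt_eq1 gT (p : nat) (x : gT) :
  (prime p -> p %| #[x] -> False) -> x.`_p = 1.
Proof.
move=> np; apply/constt1P/pnatP=> // r pr rx; rewrite !inE /=.
by apply/eqP=> rp; apply: np; rewrite -rp.
Qed.

Lemma constt_prime_neq gT (p q : nat) (x : gT) : p.-elt x -> q != p -> x.`_q = 1.
Proof.
move=> px npq; apply: constt_eq1 => pq qx.
by move/(pnatP _ (order_gt0 x)): px => /(_ q pq qx); rewrite inE (negPf npq).
Qed.

Lemma p_elt_neq_eq1 gT (p q : nat) (x : gT) : p.-elt x -> q.-elt x -> q != p -> x = 1.
Proof. by move=> px qx npq; rewrite -(constt_p_elt qx) (constt_prime_neq px). Qed.

Lemma p_elt_constt_eq1 gT (p : nat) (x : gT) :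
  (forall q, prime q -> q != p -> x.`_q = 1) -> p.-elt x.
Proof.
move=> x1; apply/pnatP=> // q pq qx; rewrite inE /=; apply/negPn/negP => npq.
by have /constt1P := x1 q pq npq; rewrite /p_elt p'natE // qx.
Qed.

Lemma constt_cycle_mem gT (x y : gT) :
  (forall q, prime q -> x.`_q \in <[y]>) -> x \in <[y]>.
Proof.
move=> xy; rewrite -(prod_constt x); apply: group_prod => q _.
case pq: (prime q); first exact: xy.
by rewrite constt_eq1 ?group1 // pq.
Qed.

(** This is why a class of nontrivial elements generating different cyclic subgroups consists of
    [p]-elements for a single prime [p]. *)
Lemma comparable_constt_p_elt gT (x y : gT) : y != 1 -> x \notin <[y]> ->
    (forall q, prime q -> (x.`_q \in <[y]>) || (y \in <[x.`_q]>)) ->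
  exists p : nat, [/\ prime p, p.-elt x & p.-elt y].
Proof.
move=> y1 nxy cmp.
(* If x.`_q is not in <[y]> then y is a q-element, and the other constituents
   of x are trivial. *)
case: (pickP [pred i : 'I_#[x].+1 | prime i && (x.`_(i : nat) \notin <[y]>)]) => [i|no].
  case/andP=> /=; set q := nat_of_ord i => pq nq.
  have yq : y \in <[x.`_q]> by have := cmp q pq; rewrite (negPf nq).
  have qy : q.-elt y := mem_p_elt (p_elt_constt q x) yq.
  exists q; split=> //; apply: p_elt_constt_eq1 => l pl nlq.
  case/orP: (cmp l pl) => h.
    exact: (p_elt_neq_eq1 (mem_p_elt qy h) (p_elt_constt l x)).
  by case/eqP: y1; apply: (p_elt_neq_eq1 qy (mem_p_elt (p_elt_constt l x) h)).
case/negP: nxy; apply: constt_cycle_mem => q pq.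
case qx: (q %| #[x]); last by rewrite constt_eq1 ?group1 ?qx.
have qlt : q < #[x].+1 by rewrite ltnS dvdn_leq.
by have /= := no (Ordinal qlt); rewrite pq /= => /negbFE.
Qed.

(** * Closed neighbourhoods and the shape of twin classes *)

Definition pnb gT (G : {set gT}) (x : gT) :=
  [set y in G | (y \in <[x]>) || (x \in <[y]>)].

Definition twins gT (G : {set gT}) (x : gT) := [set y in G | pnb G y == pnb G x].

Lemma mem_pnb gT (G : {set gT}) x y : x \in G -> y \in G ->
  (y \in pnb G x) = (x \in pnb G y).
Proof. by move=> Gx Gy; rewrite !inE Gx Gy orbC. Qed.

Lemma pnb_refl gT (G : {set gT}) x : x \in G -> x \in pnb G x.
Proof. by move=> Gx; rewrite inE Gx cycle_id. Qed.

Lemma twins_refl gT (G : {set gT}) x : x \in G -> x \in twins G x.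
Proof. by move=> Gx; rewrite inE Gx eqxx. Qed.

Lemma pnb1 gT (G : {group gT}) : pnb G 1 = G.
Proof. by apply/setP=> y; rewrite inE group1 orbT andbT. Qed.

Lemma eq_pnb_cycle gT (G : {set gT}) x y : <[x]> = <[y]> -> pnb G x = pnb G y.
Proof. by move=> xy; apply/setP=> z; rewrite !inE xy -!cycle_subG xy. Qed.

Lemma eq_twins gT (G : {set gT}) x y : pnb G x = pnb G y -> twins G x = twins G y.
Proof. by move=> xy; apply/setP=> z; rewrite !inE xy. Qed.

Lemma twins_pnb gT (G : {set gT}) x y : y \in twins G x -> pnb G y = pnb G x.
Proof. by rewrite inE => /andP[_ /eqP]. Qed.

Lemma twins_comparable gT (G : {set gT}) x y z : y \in twins G x ->
  z \in twins G x -> (y \in <[z]>) || (z \in <[y]>).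
Proof.
rewrite !inE => /andP[Gy /eqP yx] /andP[Gz /eqP zx].
by have := pnb_refl Gy; rewrite yx -zx inE Gy.
Qed.

Definition twin_top gT (G : {set gT}) (x : gT) := [arg max_(t > x in twins G x) #[t]].
Definition twin_bot gT (G : {set gT}) (x : gT) := [arg min_(t < x in twins G x) #[t]].

(** Twins are neighbours of each other, so the cyclic subgroups they generate form a chain; the
    element of largest order generates the top of it. *)
Lemma twin_topP gT (G : {set gT}) x : x \in G ->
  twin_top G x \in twins G x /\
  (forall y, y \in twins G x -> y \in <[twin_top G x]>).
Proof.
move=> Gx; rewrite /twin_top; case: arg_maxnP => [|t tx tmax].
  exact: twins_refl.
split=> // y yx; case/orP: (twins_comparable yx tx) => // ty.
by rewrite (mem_cycle_geq ty (tmax _ yx)) cycle_id.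
Qed.

Lemma twin_botP gT (G : {set gT}) x : x \in G ->
  twin_bot G x \in twins G x /\
  (forall y, y \in twins G x -> twin_bot G x \in <[y]>).
Proof.
move=> Gx; rewrite /twin_bot; case: arg_minnP => [|t tx tmin].
  exact: twins_refl.
split=> // y yx; case/orP: (twins_comparable tx yx) => // ty.
by rewrite (mem_cycle_geq ty (tmin _ yx)) cycle_id.
Qed.

Lemma cycle_sub_mem gT (G : {group gT}) x y : x \in G -> y \in <[x]> -> y \in G.
Proof.
by move=> Gx; rewrite -!cycle_subG => /subset_trans; apply; rewrite cycle_subG.
Qed.

(** The constituents of [x] lie in [<[x]>], so each is comparable with [y]. Asking only for an
    inclusion lets this serve both twins and dominating vertices. *)
Lemma dominated_cycle_p_elt gT (G : {group gT}) x y : x \in G -> y \in <[x]> -> y != 1 ->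
  <[y]> != <[x]> -> <[x]> \subset pnb G y -> exists2 p : nat, prime p & p.-elt x.
Proof.
move=> Gx yx y1 nyx sub.
have nxy : x \notin <[y]>.
  by apply: contra nyx => xy; rewrite eqEsubset !cycle_subG yx xy.
have [q pq|p [pp px _]] := comparable_constt_p_elt y1 nxy; last by exists p.
have : x.`_q \in pnb G y by apply: (subsetP sub); apply: cycle_constt.
by rewrite inE => /andP[].
Qed.

Lemma cycle_sub_pnb gT (G : {group gT}) x : x \in G -> <[x]> \subset pnb G x.
Proof. by move=> Gx; apply/subsetP=> y yx; rewrite inE yx (cycle_sub_mem Gx). Qed.

Lemma twins_p_elt gT (G : {group gT}) x y : x \in G -> y \in <[x]> -> y != 1 ->
  <[y]> != <[x]> -> pnb G y = pnb G x -> exists2 p : nat, prime p & p.-elt x.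
Proof.
move=> Gx yx y1 nyx eyx; apply: (dominated_cycle_p_elt Gx yx) => //.
by rewrite eyx cycle_sub_pnb.
Qed.

(** The subgroups of [<[x]>] form a chain. What lies below [y] lies below [x], and what lies above
    [y] lies above [z]; conversely, a neighbour of [x] and [z] is below [z], inside the chain, or
    above [x]. *)
Lemma twins_convex gT (G : {group gT}) (p : nat) x y z : x \in G -> p.-elt x ->
  y \in <[x]> -> z \in <[y]> -> pnb G z = pnb G x -> pnb G y = pnb G x.
Proof.
move=> Gx px yx zy zx; have Gy := cycle_sub_mem Gx yx.
apply/eqP; rewrite eqEsubset; apply/andP; split; apply/subsetP=> w.
  case/setIdP=> Gw /orP[wy|yw].
    by rewrite inE Gw (mem_cycle_trans wy yx).
  by rewrite -zx inE Gw (mem_cycle_trans zy yw) orbT.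
rewrite -zx=> wz; have : w \in pnb G x by rewrite -zx.
case/setIdP: wz => Gw /orP[wz _|zw].
  by rewrite inE Gw (mem_cycle_trans wz zy).
case/setIdP=> _ /orP[wx|xw]; last by rewrite inE Gw (mem_cycle_trans yx xw) orbT.
by rewrite inE Gw (p_elt_cycle_chain px wx yx).
Qed.

Lemma twins_neq1 gT (G : {group gT}) x y : x \notin twins G 1 -> x \in G ->
  y \in twins G x -> y != 1.
Proof.
move=> nx1 Gx yx; apply: contra nx1 => /eqP y1.
by rewrite inE Gx -(twins_pnb yx) y1 eqxx.
Qed.

Lemma mem_twins_order gT (G : {group gT}) x y : x \in G -> x \notin twins G 1 ->
  (y \in twins G x) = (y \in <[twin_top G x]>) && (#[twin_bot G x] <= #[y]).
Proof.
move=> Gx nx1; have [tx tP] := twin_topP Gx; have [vx vP] := twin_botP Gx.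
set t := twin_top G x in tx tP *; set v := twin_bot G x in vx vP *.
apply/idP/andP=> [yx|[yt vy]]; first by rewrite tP ?order_mem_leq ?vP.
have [Gt et] := setIdP tx; have vt := tP v vx.
have Gy := cycle_sub_mem Gt yt.
have eqt : pnb G y = pnb G t -> y \in twins G x.
  by move=> yt'; rewrite inE Gy yt' (twins_pnb tx) eqxx.
have evt : pnb G v = pnb G t by rewrite (twins_pnb tx) (twins_pnb vx).
(* If top and bottom generate the same subgroup, the order bound makes [y] a generator too;
   otherwise [t] is a [p]-element and convexity applies. *)
apply: eqt; have [evt'|nvt] := eqVneq <[v]> <[t]>.
  by apply/eq_pnb_cycle/(mem_cycle_geq yt); rewrite orderE -evt'.
have [p pp pt] := twins_p_elt Gt vt (twins_neq1 nx1 Gx vx) nvt evt.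
apply: (twins_convex Gt pt yt _ evt).
case/orP: (p_elt_cycle_chain pt vt yt) => // yv.
by rewrite (mem_cycle_geq yv vy) cycle_id.
Qed.

Lemma constt_cycle gT (pi : nat_pred) (x y : gT) : x \in <[y]> -> x.`_pi \in <[y.`_pi]>.
Proof. by case/cycleP=> k ->; rewrite consttX mem_cycle. Qed.

(** * Sizes of twin classes, and the largest order in a class *)

Lemma card_generators gT (G : {group gT}) x : x \in G ->
  #|[set y in G | <[y]> == <[x]>]| = totient #[x].
Proof.
move=> Gx; rewrite totient_gen; apply: eq_card => y; rewrite !inE /generator eq_sym.
by apply: andb_idl => /eqP xy; rewrite -cycle_subG -xy cycle_subG.
Qed.

Lemma generators_twins gT (G : {set gT}) x :
  [set y in G | <[y]> == <[x]>] \subset twins G x.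
Proof.
apply/subsetP=> y /setIdP[Gy /eqP xy]; rewrite inE Gy /=.
by apply/eqP/eq_pnb_cycle.
Qed.

Lemma totient_leq_twins gT (G : {group gT}) x : x \in G -> totient #[x] <= #|twins G x|.
Proof. by move=> Gx; rewrite -(card_generators Gx) subset_leq_card ?generators_twins. Qed.

(** The class of [y] has at least [totient #[y]] elements. The class of [x] either consists of the
    generators of [<[x]>], and totients are compared, or it consists of [p]-elements; then [y] is a
    [p]-element of larger order than all of them, and the inequality is strict. *)
Lemma card_twins_above gT (G : {group gT}) x y : x \notin twins G 1 -> y \in G ->
    x \in <[y]> -> pnb G x != pnb G y ->
  #|twins G x| < #|twins G y| \/
  [/\ #|twins G x| = #|twins G y|, odd #[x] & #[y] = #[x].*2].
Proof.
move=> nx1 Gy xy nexy; have Gx := cycle_sub_mem Gy xy.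
have [tx tP] := twin_topP Gx; have [vx vP] := twin_botP Gx.
set t := twin_top G x in tx tP *; set v := twin_bot G x in vx vP *.
have [Gt _] := setIdP tx; have vt := tP v vx; have [Gv _] := setIdP vx.
have ext : pnb G x = pnb G t by rewrite (twins_pnb tx).
have evt : pnb G v = pnb G t by rewrite (twins_pnb tx) (twins_pnb vx).
have leT := totient_leq_twins Gy.
(* Every twin of [x] lies between [v] and [t], so here all twins generate one subgroup. *)
have [evt'|nvt] := eqVneq <[v]> <[t]>.
  have sub : twins G x \subset [set z in G | <[z]> == <[x]>].
    have gen z : z \in twins G x -> <[z]> = <[v]>.
      move=> zx; apply/eqP; rewrite eqEsubset {1}evt' !cycle_subG vP // tP //.
    apply/subsetP=> z zx; rewrite inE (gen z) ?(gen x) ?twins_refl ?eqxx //.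
    by case/setIdP: zx => ->.
  have := subset_leq_card sub; rewrite card_generators //.
  have := totient_leq_twins Gx.
  have dxy : #[x] %| #[y] by rewrite -(mem_cycle_dvdn xy (cycle_id y)).
  have nxy : #[x] != #[y].
    rewrite -(eq_cycle_order xy (cycle_id y)).
    by apply: contra nexy => /eqP/eq_pnb_cycle ->.
  have := dvdn_leq_totient dxy (order_gt0 y).
  have := dvdn_eq_totient dxy (order_gt0 y) nxy.
  move=> eqt h1 h2 h3; move: leT => h4.
  have [|lt] := leqP #|twins G y| #|twins G x|; last by left.
  move=> h5; right.
  have le : totient #[y] <= totient #[x] := leq_trans h4 (leq_trans h5 h3).
  have eqtot : totient #[x] = totient #[y] by apply/eqP; rewrite eqn_leq h1 le.
  have [ox ->] := eqt eqtot; split=> //; apply/eqP; rewrite eqn_leq h5 andbT.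
  by rewrite (leq_trans h3) // eqtot.
have [p pp pt] := twins_p_elt Gt vt (twins_neq1 nx1 Gx vx) nvt evt.
(* Were [y] inside [<[t]>], it would lie between the twins [x] and [t], hence be their twin by
   convexity. *)
have ty : t \in <[y]>.
  have : y \in pnb G t by rewrite -ext inE Gy xy orbT.
  case/setIdP=> _ /orP[yt|//]; case/eqP: nexy.
  by rewrite ext (twins_convex Gt pt yt xy ext).
(* A constituent u of y that is a nontrivial p'-element would make v * u
   adjacent to v but not to its twin t. *)
have py : p.-elt y.
  apply: p_elt_constt_eq1 => q pq npq; set u := y.`_q.
  have pv := mem_p_elt pt vt; have vy := mem_cycle_trans vt ty.
  have uy : u \in <[y]> by apply: cycle_constt.
  have cvu : commute v u by apply: (centsP (cycle_abelian y)).
  have qu : q.-elt u by apply: p_elt_constt.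
  have wp : (v * u).`_p = v.
    by rewrite consttM // constt_p_elt // (constt_prime_neq qu) ?mulg1 // eq_sym.
  have wq : (v * u).`_q = u.
    by rewrite consttM // (constt_prime_neq pv) // mul1g constt_p_elt.
  have Gw : v * u \in G by rewrite groupM // (cycle_sub_mem Gy).
  have vw : v \in <[v * u]> by rewrite -{1}wp cycle_constt.
  have : v * u \in pnb G t by rewrite -evt inE Gw vw orbT.
  case/setIdP=> _ /orP[/(mem_p_elt pt) pw|tw].
    by rewrite -wq (constt_prime_neq pw).
  have := constt_cycle p tw; rewrite wp constt_p_elt // => tv.
  by case/eqP: nvt; apply/eqP; rewrite eqEsubset !cycle_subG vt tv.
(* With [#[t] = p ^ r] and [r < s], the class of [x] has fewer than [p ^ r] elements, while the
   totient of [p ^ s] is at least [p ^ s.-1], hence at least [p ^ r]. *)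
left; have subx : twins G x \subset <[t]>^#.
  apply/subsetP=> z zx; rewrite !inE tP // andbT.
  exact: twins_neq1 nx1 Gx zx.
have := subset_leq_card subx; have := cardsD1 1 <[t]>; rewrite group1.
have [r tr] := p_natP pt; have [s ys] := p_natP py.
have ltrs : r < s.
  rewrite -(ltn_exp2l _ _ (prime_gt1 pp)) -tr -ys ltn_neqAle order_mem_leq // andbT.
  rewrite -(eq_cycle_order ty (cycle_id y)).
  by apply: contra nexy => /eqP/eq_pnb_cycle; rewrite ext => ->.
rewrite -orderE => cT cX; move: leT cT cX; rewrite ys tr.
case: s ltrs {ys} => // s; rewrite ltnS => lers.
rewrite totient_pfactor //=.
have := leq_pexp2l (prime_gt0 pp) lers; have := prime_gt1 pp.
move: (p ^ r)%N (p ^ s)%N => a b; case: p {pp pt py tr} => [|[|p]] //= _ ab leT cT cX.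
apply: leq_trans leT; apply: leq_trans (leq_pmull b (ltn0Sn p)).
by apply: leq_trans ab; rewrite cT ltnS.
Qed.

(* Of the neighbours of x, those counted by [smaller] lie below x, and those
   counted by [tied] all lie above a top twin of odd order or all below one of
   even order. *)
Definition smaller gT (G : {set gT}) (x : gT) :=
  [set y in G | [&& y \in pnb G x, y \notin twins G 1 & #|twins G y| < #|twins G x|]].

Definition tied gT (G : {set gT}) (x : gT) :=
  [set y in G | [&& y \in pnb G x, y \notin twins G 1, y \notin twins G x
                  & #|twins G y| == #|twins G x|]].

Lemma mem_smaller gT (G : {set gT}) x y : (y \in smaller G x) =
  [&& y \in G, y \in pnb G x, y \notin twins G 1 & #|twins G y| < #|twins G x|].
Proof. by rewrite /smaller in_set. Qed.

Lemma mem_tied gT (G : {set gT}) x y : (y \in tied G x) =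
  [&& y \in G, y \in pnb G x, y \notin twins G 1, y \notin twins G x
    & #|twins G y| == #|twins G x|].
Proof. by rewrite /tied in_set. Qed.

Lemma not_twins_neq gT (G : {set gT}) x y :
  y \in G -> y \notin twins G x -> pnb G y != pnb G x.
Proof. by move=> Gy; rewrite inE Gy. Qed.

(** The group [<[t]>] is the disjoint union of the dominating vertices, the class of [x] and a rest
    [B], which [card_twins_above] identifies through class sizes. *)
Lemma order_twin_top gT (G : {group gT}) x : x \in G -> x \notin twins G 1 ->
    twins G 1 \subset <[twin_top G x]> ->
  (#[twin_top G x] = #|twins G 1| + #|twins G x| + #|smaller G x| +
    (if odd #[twin_top G x] then 0 else #|tied G x|))%N /\
  (~~ odd #[twin_top G x] -> ~~ odd #|tied G x|).
Proof.
move=> Gx nx1 sD; have [tx tP] := twin_topP Gx.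
set t := twin_top G x in sD tx tP *.
have [Gt _] := setIdP tx.
have ext : pnb G x = pnb G t by rewrite (twins_pnb tx).
have nt1 : t \notin twins G 1 by apply: contra nx1; rewrite !inE Gx ext => /andP[].
have below y : y \in <[t]> -> y \notin twins G 1 -> y \notin twins G x ->
    #|twins G y| < #|twins G x| \/
    [/\ #|twins G y| = #|twins G x|, odd #[y] & #[t] = #[y].*2].
  move=> yt ny1 nyx; rewrite (eq_twins ext).
  by apply: card_twins_above => //; rewrite -ext not_twins_neq // (cycle_sub_mem Gt).
have above y : y \in G -> t \in <[y]> -> y \notin twins G x ->
    #|twins G x| < #|twins G y| \/ (#|twins G x| = #|twins G y| /\ odd #[t]).
  move=> Gy ty nyx; rewrite (eq_twins ext).
  have nty : pnb G t != pnb G y by rewrite eq_sym -ext not_twins_neq.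
  by case: (card_twins_above nt1 Gy ty nty) => [|[]]; [left | right].
pose B := [set y in <[t]> | (y \notin twins G 1) && (y \notin twins G x)].
have pnbt y : y \in pnb G x -> (y \in <[t]>) || (t \in <[y]>).
  by rewrite ext => /setIdP[].
(* A tie with a vertex below [t] makes [#[t]] even, and a tie with one above makes it odd; so the
   parity of [#[t]] decides whether [tied] lies inside [<[t]>]. *)
have BE : B = if odd #[t] then smaller G x else smaller G x :|: tied G x.
  apply/setP=> y; rewrite in_set; apply/idP/idP.
    case/and3P=> yt ny1 nyx; have Gy := cycle_sub_mem Gt yt.
    have yx : y \in pnb G x by rewrite ext inE Gy yt.
    have [lt|[eq oy t2]] := below y yt ny1 nyx.
      by case: ifP => _; rewrite ?in_setU mem_smaller Gy ny1 lt yx.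
    by rewrite t2 odd_double in_setU mem_tied Gy yx ny1 nyx eq eqxx orbT.
  have absurd_above : y \in G -> t \in <[y]> -> y \notin twins G x ->
      #|twins G y| <= #|twins G x| -> odd #[t] /\ #|twins G y| = #|twins G x|.
    move=> Gy ty nyx le; case: (above y Gy ty nyx) => [|[-> ->]] //.
    by rewrite ltnNge le.
  have sm : y \in smaller G x ->
      [&& y \in <[t]>, y \notin twins G 1 & y \notin twins G x].
    rewrite mem_smaller => /and4P[Gy yx ny1 lt].
    have nyx : y \notin twins G x.
      by apply: contraL lt => /twins_pnb/eq_twins->; rewrite ltnn.
    rewrite ny1 nyx !andbT; case/orP: (pnbt y yx) => // ty.
    by have [_ eq] := absurd_above Gy ty nyx (ltnW lt); rewrite eq ltnn in lt.
  case: ifP => ot; first exact: sm.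
  case/setUP=> [/sm //|]; rewrite mem_tied => /and5P[Gy yx ny1 nyx /eqP eq].
  rewrite ny1 nyx !andbT; case/orP: (pnbt y yx) => // ty.
  by have [] := absurd_above Gy ty nyx (eq_leq eq); rewrite ot.
have cardt : #[t] = (#|twins G 1| + #|twins G x| + #|B|)%N.
  have dis : [disjoint twins G 1 & twins G x].
    apply/pred0P=> y /=; apply: contraNF nx1 => /andP[y1 yx].
    by rewrite inE Gx -(twins_pnb yx) (twins_pnb y1) eqxx.
  have st : twins G x \subset <[t]> by apply/subsetP.
  have -> : B = <[t]> :\: (twins G 1 :|: twins G x).
    by apply/setP=> y; rewrite in_setD in_setU negb_or andbC inE.
  rewrite cardsD (setIidPr _) ?subUset ?sD // cardsU.
  rewrite disjoint_setI0 // cards0 subn0 subnKC ?orderE //.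
  rewrite -[X in (X <= _)%N]subn0 -(cards0 gT) -(disjoint_setI0 dis) -cardsU.
  by rewrite subset_leq_card // subUset sD.
split.
  rewrite {1}cardt BE; case: ifP => _; first by rewrite addn0.
  rewrite cardsU disjoint_setI0 ?cards0 ?subn0 ?addnA //.
  apply/pred0P=> y /=; rewrite mem_smaller mem_tied.
  by case: eqP => [->|]; rewrite ?ltnn ?andbF.
(* For [#[t]] even, tied vertices lie in [<[t]>] and have order half of [#[t]], odd and greater than
   1. They are the generators of one subgroup, counted by an even totient. *)
move=> et; have [->|[e eE]] := set_0Vmem (tied G x); first by rewrite cards0.
have tiedP y : y \in tied G x -> [/\ y \in <[t]>, y != 1, odd #[y] & #[t] = #[y].*2].
  case/setIdP=> Gy /and4P[yx ny1 nyx /eqP eq].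
  have yt : y \in <[t]>.
    case/orP: (pnbt y yx) => // ty; have [] := above y Gy ty nyx; first by rewrite eq ltnn.
    by rewrite (negPf et) => -[].
  have [|[_ oy t2]] := below y yt ny1 nyx; first by rewrite eq ltnn.
  split=> //; apply: contra ny1 => /eqP ->; exact: twins_refl.
have [te e1 oe t2] := tiedP e eE; have Ge := cycle_sub_mem Gt te.
suff -> : tied G x = [set y in G | <[y]> == <[e]>].
  by rewrite card_generators ?totient_odd_even // order_gt1.
apply/setP=> y; apply/idP/setIdP=> [yE|[Gy /eqP ye]].
  have [yt _ _ t2'] := tiedP y yE; split; first exact: cycle_sub_mem Gt yt.
  by rewrite (eq_cycle_order yt te) -(inj_eq double_inj) -t2 -t2'.
have eye := eq_pnb_cycle G ye.
have yx : y \in pnb G x.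
  by rewrite ext inE Gy (mem_cycle_trans _ te) // -ye cycle_id.
move: eE; rewrite mem_tied => /and5P[_ _ ne1 nex eq].
rewrite mem_tied Gy yx (eq_twins eye) eq andbT /=.
by move: ne1 nex; rewrite ![_ \in twins _ _]inE Gy Ge eye => -> ->.
Qed.

(** * Dominating vertices *)

(* [pdiv #|G|] makes "G has prime power order" a condition on #|G| alone;
   it holds for the trivial group since [pdiv 1 = 1]. *)
Definition primary gT (G : {set gT}) := (pdiv #|G|).-group G.

(** The top twin of 1 is a [p]-element, so by convexity everything between it and 1 is
    dominating. *)
Lemma primary_dominating_cycle gT (G : {group gT}) : primary G ->
  exists2 x, x \in G & twins G 1 = <[x]>.
Proof.
move=> pG; have [tx tP] := twin_topP (group1 G).
have Gt : twin_top G 1 \in G by case/setIdP: tx.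
exists (twin_top G 1) => //; apply/setP=> y; apply/idP/idP => [|yt]; first exact: tP.
rewrite inE (cycle_sub_mem Gt yt) -(twins_pnb tx); apply/eqP.
apply: (twins_convex Gt (mem_p_elt pG Gt) yt (group1 _)).
by rewrite (twins_pnb tx).
Qed.

Lemma small_dominating_cycle gT (G : {group gT}) : #|twins G 1| <= 1 ->
  exists2 x, x \in G & twins G 1 = <[x]>.
Proof.
move=> le; exists 1 => //; apply/esym/eqP.
by rewrite cycle1 eqEcard sub1set twins_refl ?cards1.
Qed.

Lemma pgroup_elts gT (G : {group gT}) (p : nat) :
  (forall x, x \in G -> p.-elt x) -> p.-group G.
Proof.
move=> pG; apply/pgroupP=> q pq /(Cauchy pq)[x Gx ox].
by have := pG x Gx; rewrite /p_elt ox pnatE.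
Qed.

(** Let [x] be a nontrivial dominating vertex. An element [g] outside [<[x]>] would satisfy [x \in
    <[g]>], making [g] and [x] [p]-elements; all constituents being comparable with [x], the whole
    group would be a [p]-group. So [x] generates [G]. *)
Lemma dominating_cyclic gT (G : {group gT}) :
  ~~ primary G -> 1 < #|twins G 1| -> cyclic G.
Proof.
move=> nP D1; have : 0 < #|twins G 1 :\ 1|.
  by move: D1; rewrite (cardsD1 1) twins_refl.
case/card_gt0P=> x; rewrite in_setD1 => /andP[x1 xD].
have [Gx _] := setIdP xD; have ex : pnb G x = G by rewrite (twins_pnb xD) pnb1.
apply/cyclicP; exists x; apply/eqP; rewrite eqEsubset cycle_subG Gx andbT.
apply/subsetP=> g Gg; apply: contraR nP => ngx.
have xg : x \in <[g]>.
  by have := Gg; rewrite -{1}ex inE Gg (negPf ngx).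
have nxg : <[x]> != <[g]> by apply: contra ngx => /eqP ->; apply: cycle_id.
have [|p pp pg] := dominated_cycle_p_elt Gg xg x1 nxg.
  by rewrite ex cycle_subG.
have px := mem_p_elt pg xg.
have pG : p.-group G.
  apply: pgroup_elts => h Gh; apply: p_elt_constt_eq1 => q pq npq.
  have : h.`_q \in pnb G x by rewrite ex (cycle_sub_mem Gh) ?cycle_constt.
  case/setIdP=> _ /orP[/(mem_p_elt px) ph|xh].
    exact: p_elt_neq_eq1 ph (p_elt_constt _ _) npq.
  by case/eqP: x1; apply: p_elt_neq_eq1 px (mem_p_elt (p_elt_constt _ _) xh) npq.
have G1 : 1 < #|G|.
  by apply: leq_trans D1 _; apply/subset_leq_card/subsetP => y /setIdP[].
have dG : pdiv #|G| \in \pi(G) by rewrite pi_pdiv.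
have := pnatPpi pG dG; rewrite inE => /eqP dE.
by rewrite /primary dE.
Qed.

(** * Matching elements by order *)

(** Different bounds [m] and [n] may cut off the same elements. Once both sets are moved into
    [<[u]>] they are nested, so equal size makes them equal. *)
Lemma cycle_order_count gT hT (t : gT) (u : hT) m n k : #[t] = #[u] ->
    #|[set y in <[t]> | m <= #[y]]| = #|[set z in <[u]> | n <= #[z]]| ->
  #|[set y in <[t]> | (m <= #[y]) && (#[y] == k)]|
    = #|[set z in <[u]> | (n <= #[z]) && (#[z] == k)]|.
Proof.
move=> tu.
have : <[t]> \isog <[u]>.
  by rewrite isog_cyclic_card ?cycle_cyclic // -!orderE tu eqxx.
case/isogP=> h injh ht.
have im (P : nat -> bool) : h @: [set y in <[t]> | P #[y]] = [set z in <[u]> | P #[z]].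
  apply/setP=> z; apply/imsetP/setIdP => [[y /setIdP[yt Py] ->]|[]].
    by rewrite -ht mem_morphim // order_injm.
  rewrite -ht => /morphimP[y _ yt ->]; rewrite order_injm // => Py.
  by exists y; rewrite // inE yt.
have card (P : nat -> bool) : #|[set y in <[t]> | P #[y]]| = #|[set z in <[u]> | P #[z]]|.
  rewrite -im card_in_imset // => x y /setIdP[xt _] /setIdP[yt _].
  exact: (injmP injh).
rewrite (card (leq m)) => eq; rewrite (card (fun i => (m <= i) && (i == k))).
have sub a b : a <= b ->
    [set z in <[u]> | b <= #[z]] \subset [set z in <[u]> | a <= #[z]].
  move=> ab; apply/subsetP=> z; rewrite !inE => /andP[-> /=]; exact: leq_trans.
have E : [set z in <[u]> | m <= #[z]] = [set z in <[u]> | n <= #[z]].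
  case/orP: (leq_total m n) => /sub le; apply/eqP.
    by rewrite eq_sym eqEcard le eq leqnn.
  by rewrite eqEcard le eq leqnn.
by apply: eq_card => z; move/setP/(_ z): E; rewrite !inE !andbA => ->.
Qed.

(** Corresponding fibres are matched by position in their enumerations; [z0] is the default of
    [nth], never returned on [A]. *)
Lemma exists_bijection (S T : finType) (K : eqType) (z0 : T) (A : {set S}) (B : {set T})
    (k : S -> K) (l : T -> K) :
    (forall c, #|[set x in A | k x == c]| = #|[set y in B | l y == c]|) ->
  exists g : S -> T,
    [/\ {in A &, injective g}, g @: A = B & {in A, forall x, l (g x) = k x}].
Proof.
move=> eqc.
pose a c := enum [set x in A | k x == c]; pose b c := enum [set y in B | l y == c].
have sz c : size (a c) = size (b c) by rewrite -!cardE eqc.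
pose g x := nth z0 (b (k x)) (index x (a (k x))).
have ga x : x \in A -> x \in a (k x) by move=> Ax; rewrite mem_enum inE Ax eqxx.
have gb x : x \in A -> g x \in b (k x).
  by move=> Ax; rewrite mem_nth // -sz index_mem ga.
have gl x : x \in A -> g x \in B /\ l (g x) = k x.
  by move/gb; rewrite mem_enum inE => /andP[-> /eqP].
have ginj : {in A &, injective g}.
  move=> x y Ax Ay gxy; have kxy : k x = k y by rewrite -(gl x Ax).2 -(gl y Ay).2 gxy.
  move/eqP: gxy; rewrite /g -kxy nth_uniq ?enum_uniq -?sz ?index_mem ?ga //.
    by move/eqP => ixy; rewrite -(nth_index x (ga x Ax)) ixy nth_index // kxy ga.
  by rewrite kxy ga.
exists g; split=> // [|x /gl[]//].
apply/eqP; rewrite eqEsubset; apply/andP; split; apply/subsetP=> y.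
  by case/imsetP=> x Ax ->; case: (gl x Ax).
move=> By; have yb : y \in b (l y) by rewrite mem_enum inE By eqxx.
have lt : index y (b (l y)) < size (a (l y)) by rewrite sz index_mem.
have [x0 _] : exists x0 : S, x0 \in a (l y).
  by case: (a (l y)) lt => // x s _; exists x; rewrite mem_head.
pose x := nth x0 (a (l y)) (index y (b (l y))).
have : x \in a (l y) by apply: mem_nth.
rewrite mem_enum inE => /andP[Ax /eqP kx]; apply/imsetP; exists x => //.
by rewrite /g kx index_uniq ?enum_uniq // nth_index.
Qed.

(** * Invariants of power graph isomorphisms *)

Definition pnb_iso gT hT (G : {set gT}) (H : {set hT}) (f : gT -> hT) :=
  [/\ {in G &, injective f}, f @: G = H &
      {in G &, forall x y, (f y \in pnb H (f x)) = (y \in pnb G x)}].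

Lemma pow_graph_iso_pnb gT hT (G : {set gT}) (H : {set hT}) :
  pow_graph_iso G H <-> exists f, pnb_iso G H f.
Proof.
have pnbE (rT : finGroupType) (K : {set rT}) x y : x \in K -> y \in K ->
    (y \in pnb K x) = (x == y) || pow_adj x y.
  by move=> Kx Ky; rewrite /pow_adj inE Ky /=; case: eqP => // ->; rewrite cycle_id.
have adjE (rT : finGroupType) (K : {set rT}) x y : x \in K -> y \in K ->
    pow_adj x y = (x != y) && (y \in pnb K x).
  by move=> Kx Ky; rewrite /pow_adj inE Ky.
split=> [[f [inj im adj]]|[f [inj im adj]]]; exists f; split=> // x y Gx Gy;
  have [Hx Hy] : f x \in H /\ f y \in H by rewrite -im !imset_f.
  by rewrite !pnbE // adj // (inj_in_eq inj).
by rewrite (adjE _ H) // (adjE _ G) // adj // (inj_in_eq inj).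
Qed.

Lemma imset_setId (S T : finType) (f : S -> T) (A : {set S}) (B : {set T}) P Q :
  f @: A = B -> {in A, forall x, Q (f x) = P x} ->
  f @: [set x in A | P x] = [set y in B | Q y].
Proof.
move=> im PQ; apply/setP=> y; apply/imsetP/setIdP => [[x /setIdP[Ax Px] ->]|[]].
  by rewrite -im imset_f // PQ.
rewrite -im => /imsetP[x Ax ->]; rewrite PQ // => Px.
by exists x; rewrite // inE Ax.
Qed.

Lemma card_setId (S T : finType) (f : S -> T) (A : {set S}) (B : {set T}) P Q :
  {in A &, injective f} -> f @: A = B -> {in A, forall x, Q (f x) = P x} ->
  #|[set x in A | P x]| = #|[set y in B | Q y]|.
Proof.
move=> inj im PQ; rewrite -(imset_setId im PQ) card_in_imset // => x y.
by case/setIdP=> Ax _ /setIdP[Ay _]; apply: inj.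
Qed.

Lemma pnb_iso_mem gT hT (G : {set gT}) (H : {set hT}) f x :
  pnb_iso G H f -> x \in G -> f x \in H.
Proof. by case=> _ <- _ Gx; rewrite imset_f. Qed.

Lemma pnb_iso_eq gT hT (G : {set gT}) (H : {set hT}) f x y :
  pnb_iso G H f -> x \in G -> y \in G ->
  (pnb H (f y) == pnb H (f x)) = (pnb G y == pnb G x).
Proof.
move=> [inj im adj] Gx Gy; apply/eqP/eqP => /setP e; apply/setP=> z.
  case Gz: (z \in G); last by rewrite !inE Gz.
  by rewrite -!adj // e.
case Hz: (z \in H); last by rewrite !inE Hz.
have /imsetP[w Gw ->] : z \in f @: G by rewrite im.
by rewrite !adj.
Qed.

Lemma pnb_iso_twins gT hT (G : {set gT}) (H : {set hT}) f x y :
  pnb_iso G H f -> x \in G -> y \in G -> (f y \in twins H (f x)) = (y \in twins G x).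
Proof.
move=> fi Gx Gy; rewrite [LHS]in_set [RHS]in_set Gy (pnb_iso_mem fi Gy).
exact: pnb_iso_eq.
Qed.

Lemma pnb_iso_twins_image gT hT (G : {set gT}) (H : {set hT}) f x :
  pnb_iso G H f -> x \in G -> f @: twins G x = twins H (f x).
Proof.
move=> fi Gx; case: (fi) => inj im adj; apply: imset_setId => // y Gy.
exact: pnb_iso_eq.
Qed.

Lemma card_pnb_iso_twins gT hT (G : {set gT}) (H : {set hT}) f x :
  pnb_iso G H f -> x \in G -> #|twins H (f x)| = #|twins G x|.
Proof.
move=> fi Gx; case: (fi) => inj im adj; rewrite -(pnb_iso_twins_image fi Gx).
rewrite card_in_imset // => y z /setIdP[Gy _] /setIdP[Gz _]; exact: inj.
Qed.

Lemma pnb_iso_twins1 gT hT (G : {group gT}) (H : {group hT}) f :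
  pnb_iso G H f -> twins H (f 1) = twins H 1.
Proof.
move=> fi; case: (fi) => inj im adj; apply: eq_twins; rewrite pnb1.
apply/setP=> z; case Hz: (z \in H); last by rewrite !inE Hz.
have /imsetP[w Gw ->] : z \in f @: G by rewrite im.
by rewrite adj // pnb1.
Qed.

Lemma pnb_iso_dominating gT hT (G : {group gT}) (H : {group hT}) f x :
  pnb_iso G H f -> x \in G -> (f x \in twins H 1) = (x \in twins G 1).
Proof. by move=> fi Gx; rewrite -(pnb_iso_twins1 fi) (pnb_iso_twins fi). Qed.

Lemma card_pnb_iso_smaller gT hT (G : {group gT}) (H : {group hT}) f x :
  pnb_iso G H f -> x \in G -> #|smaller G x| = #|smaller H (f x)|.
Proof.
move=> fi Gx; case: (fi) => inj im adj; apply: (card_setId inj im) => y Gy.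
by rewrite adj // (pnb_iso_dominating fi) // !(card_pnb_iso_twins fi).
Qed.

Lemma card_pnb_iso_tied gT hT (G : {group gT}) (H : {group hT}) f x :
  pnb_iso G H f -> x \in G -> #|tied G x| = #|tied H (f x)|.
Proof.
move=> fi Gx; case: (fi) => inj im adj; apply: (card_setId inj im) => y Gy.
by rewrite adj // (pnb_iso_dominating fi) // (pnb_iso_twins fi) // !(card_pnb_iso_twins fi).
Qed.

Lemma dominating_sub_top gT (G : {group gT}) z x : z \in G -> twins G 1 = <[z]> ->
  x \in G -> x \notin twins G 1 -> twins G 1 \subset <[x]>.
Proof.
move=> Gz D Gx nx1; have zD : z \in twins G 1 by rewrite D cycle_id.
have : x \in pnb G z by rewrite (twins_pnb zD) pnb1.
by case/setIdP=> _; rewrite D in nx1 *; rewrite (negPf nx1) cycle_subG.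
Qed.

(** Here [a] and [b] are the orders of corresponding top twins and [e] counts tied vertices. If only
    one of them were even, it would be [c + e] with [e] even, and the odd one would be [c]: the
    parities would agree. *)
Lemma eq_of_parity (a b c e : nat) :
  a = (c + if odd a then 0 else e)%N -> (~~ odd a -> ~~ odd e) ->
  b = (c + if odd b then 0 else e)%N -> (~~ odd b -> ~~ odd e) -> a = b.
Proof.
case oa: (odd a); case ob: (odd b) => ea oe eb oe'; try by rewrite ea eb.
  by move: ob; rewrite eb oddD (negPf (oe' isT)) addbF -[c]addn0 -ea oa.
by move: oa; rewrite ea oddD (negPf (oe isT)) addbF -[c]addn0 -eb ob.
Qed.

(** Both classes are upper segments, with respect to order, of cyclic groups of equal order, so
    [cycle_order_count] applies. *)
Lemma twins_order_count gT hT (G : {group gT}) (H : {group hT}) f z u x k :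
    pnb_iso G H f -> z \in G -> twins G 1 = <[z]> -> u \in H -> twins H 1 = <[u]> ->
    x \in G ->
  #|[set y in twins G x | #[y] == k]| = #|[set y in twins H (f x) | #[y] == k]|.
Proof.
move=> fi Gz Dz Hu Du Gx; have Hx := pnb_iso_mem fi Gx.
have cD : #|twins G 1| = #|twins H 1|.
  by rewrite -(pnb_iso_twins1 fi) (card_pnb_iso_twins fi).
have cx := card_pnb_iso_twins fi Gx.
suff [t [v [m [n [tv eG eH]]]]] : exists t v m n, [/\ #[t] = #[v],
    twins G x = [set y in <[t]> | m <= #[y]]
  & twins H (f x) = [set y in <[v]> | n <= #[y]]].
  have := @cycle_order_count _ _ t v m n k tv; rewrite -eG -eH cx => /(_ erefl) e.
  rewrite (_ : [set y in twins G x | _] = [set y in <[t]> | (m <= #[y]) && (#[y] == k)]).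
    by rewrite e; apply: eq_card => y; rewrite eH !inE andbA.
  by apply/setP=> y; rewrite eG !inE andbA.
have [x1|nx1] := boolP (x \in twins G 1).
  (* The dominating class is a whole cyclic group: the bound 1 excludes nothing. *)
  exists z, u, 1%N, 1%N; split.
  - by rewrite !orderE -Dz -Du.
  - by rewrite (eq_twins (twins_pnb x1)) Dz; apply/setP=> y; rewrite inE order_gt0 andbT.
  have x1' : f x \in twins H 1 by rewrite (pnb_iso_dominating fi).
  by rewrite (eq_twins (twins_pnb x1')) Du; apply/setP=> y; rewrite inE order_gt0 andbT.
have nx1' : f x \notin twins H 1 by rewrite (pnb_iso_dominating fi).
exists (twin_top G x), (twin_top H (f x)), #[twin_bot G x], #[twin_bot H (f x)]; split.
- have sub (rT : finGroupType) (K : {group rT}) w y : w \in K ->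
      twins K 1 = <[w]> -> y \in K ->
      y \notin twins K 1 -> twins K 1 \subset <[twin_top K y]>.
    move=> Kw Dw Ky ny1; have [yt _] := twin_topP Ky; have [Kt _] := setIdP yt.
    apply: (dominating_sub_top Kw) => //; apply: contra ny1 => t1.
    by rewrite inE Ky -(twins_pnb yt) (twins_pnb t1) eqxx.
  have [eG oG] := order_twin_top Gx nx1 (sub _ _ _ _ Gz Dz Gx nx1).
  have [eH oH] := order_twin_top Hx nx1' (sub _ _ _ _ Hu Du Hx nx1').
  rewrite -cD cx -(card_pnb_iso_smaller fi) // -(card_pnb_iso_tied fi) // in eH oH.
  exact: eq_of_parity eG oG eH oH.
- by apply/setP=> y; rewrite mem_twins_order // inE.
by apply/setP=> y; rewrite mem_twins_order // inE.
Qed.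

(** * Directed power graphs and Cameron's theorem *)

(* Isomorphisms of directed power graphs, in which x -> y when y \in <[x]>. *)
Definition dpow_iso gT hT (G : {set gT}) (H : {set hT}) (f : gT -> hT) :=
  [/\ {in G &, injective f}, f @: G = H &
      {in G &, forall x y, (f y \in <[f x]>) = (y \in <[x]>)}].

Lemma isog_dpow_iso gT hT (G : {group gT}) (H : {group hT}) :
  G \isog H -> exists f, dpow_iso G H f.
Proof.
case/isogP=> f injf fG; exists f; split; first exact/injmP.
  by rewrite -fG morphimEdom.
move=> x y Gx Gy /=; rewrite -!cycle_subG /= -!morphim_cycle //.
by rewrite injmSK ?cycle_subG.
Qed.

(** Between neighbours, divisibility of the orders tells the direction. *)
Lemma order_iso_dpow_iso gT hT (G : {group gT}) (H : {group hT}) f :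
  pnb_iso G H f -> {in G, forall x, #[f x] = #[x]} -> dpow_iso G H f.
Proof.
move=> fi ord; case: (fi) => inj im adj; split=> // x y Gx Gy.
have dirE (rT : finGroupType) (K : {group rT}) (u v : rT) : u \in K -> v \in K ->
    (v \in <[u]>) = (v \in pnb K u) && (#[v] %| #[u]).
  move=> Ku Kv; rewrite inE Kv /=; apply/idP/andP=> [vu|[/orP[//|uv] vu]].
    by rewrite vu -(mem_cycle_dvdn vu (cycle_id u)).
  by rewrite (mem_cycle_dvdn (cycle_id v) uv).
by rewrite (dirE _ H) ?(pnb_iso_mem fi) // (dirE _ G) // adj // !ord.
Qed.

Lemma pow_graph_iso_dpow_iso gT hT (G : {group gT}) (H : {group hT}) :
  pow_graph_iso G H -> exists f, dpow_iso G H f.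
Proof.
case/pow_graph_iso_pnb=> f fi; case: (fi) => inj im adj.
have cGH : #|G| = #|H| by rewrite -im card_in_imset.
have cD : #|twins G 1| = #|twins H 1|.
  by rewrite -(pnb_iso_twins1 fi) (card_pnb_iso_twins fi).
have pGH : primary G = primary H by rewrite /primary /pgroup cGH.
(* The exceptional case comes first: both groups are cyclic of the same order. The case distinction
   depends only on the group order and the number of dominating vertices, so it transfers to [H]. *)
have [/orP|/norP[nP]] := boolP (primary G || (#|twins G 1| <= 1)); last first.
  rewrite -ltnNge => D1; apply: isog_dpow_iso.
  by rewrite isog_cyclic_card ?dominating_cyclic -?pGH -?cD // cGH eqxx.
move=> PD.
have [z Gz Dz] : exists2 z, z \in G & twins G 1 = <[z]>.
  by case: PD; [apply: primary_dominating_cycle | apply: small_dominating_cycle].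
have [u Hu Du] : exists2 u, u \in H & twins H 1 = <[u]>.
  by rewrite pGH cD in PD; case: PD;
    [apply: primary_dominating_cycle | apply: small_dominating_cycle].
(* A bijection respecting these labels sends [x] to a twin of [f x] that has the order of [x]. *)
pose k y := (f @: twins G y, #[y]); pose l w := (twins H w, #[w]).
have [|g [ginj gim gl]] := @exists_bijection _ _ _ 1 G H k l.
  case=> C j; rewrite /k /l.
  have twE (rT : finGroupType) (K : {group rT}) y v : y \in K -> v \in K ->
      (twins K v == twins K y) = (v \in twins K y).
    move=> Ky Kv; apply/eqP/idP => [<-|]; first exact: twins_refl.
    by move/twins_pnb/eq_twins.
  have [x /andP[Gx /eqP <-{C}]|no] := pickP [pred x in G | f @: twins G x == C]; last first.
    rewrite !eq_card0 // => y; rewrite inE; apply/negP => /andP[Ky].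
      have /imsetP[v Gv ->] : y \in f @: G by rewrite im.
      rewrite xpair_eqE => /andP[eC _].
      by have := no v; rewrite inE Gv (pnb_iso_twins_image fi Gv) eC.
    by rewrite xpair_eqE => /andP[eC _]; have := no y; rewrite inE Ky eC.
  have Hx := pnb_iso_mem fi Gx.
  transitivity #|[set y in twins G x | #[y] == j]|.
    apply: eq_card => y; rewrite [LHS]in_set [RHS]in_set xpair_eqE.
    case Gy: (y \in G) => /=; last by rewrite inE Gy.
    rewrite !(pnb_iso_twins_image fi) // twE ?(pnb_iso_mem fi) //.
    by rewrite (pnb_iso_twins fi) // !inE Gy.
  transitivity #|[set y in twins H (f x) | #[y] == j]|.
    exact: twins_order_count fi Gz Dz Hu Du Gx.
  apply: eq_card => w.
  rewrite [LHS]in_set [RHS]in_set xpair_eqE.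
  case Hw: (w \in H) => /=; last by rewrite inE Hw.
  by rewrite (pnb_iso_twins_image fi) // twE // inE Hw.
exists g; apply: order_iso_dpow_iso => [|x Gx]; last by case: (gl x Gx).
have gf x : x \in G -> pnb H (g x) = pnb H (f x).
  move=> Gx; case: (gl x Gx) => e _; apply: twins_pnb.
  by rewrite -(pnb_iso_twins_image fi Gx) -e twins_refl // -gim imset_f.
split=> // x y Gx Gy; have [Hx Hy] := (pnb_iso_mem fi Gx, pnb_iso_mem fi Gy).
have [Hgx Hgy] : g x \in H /\ g y \in H by rewrite -gim !imset_f.
by rewrite gf // mem_pnb // gf // mem_pnb // adj.
Qed.

(** The order of [x] is the number of elements in [<[x]>], its out-neighbours and itself. *)
Lemma dpow_iso_order gT hT (G : {group gT}) (H : {group hT}) f x :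
  dpow_iso G H f -> x \in G -> #[f x] = #[x].
Proof.
case=> inj im dir Gx; have Hx : f x \in H by rewrite -im imset_f.
have cycE (rT : finGroupType) (K : {group rT}) u : u \in K ->
    #[u] = #|[set v in K | v \in <[u]>]|.
  move=> Ku; rewrite orderE; apply: eq_card => v; rewrite inE.
  by apply/esym/andb_idl; apply: cycle_sub_mem.
rewrite (cycE _ H) // (cycE _ G) //; symmetry.
by apply: (card_setId inj im) => y Gy; apply: dir.
Qed.

Lemma dpow_iso_pow_graph_iso gT hT (G : {set gT}) (H : {set hT}) f :
  dpow_iso G H f -> pow_graph_iso G H.
Proof.
case=> inj im dir; exists f; split=> // x y Gx Gy.
by rewrite /pow_adj !dir // (inj_in_eq inj).
Qed.

(** * Nilpotency through p-elements and constituents *)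

Definition p_elts gT (G : {set gT}) (p : nat) := [set x in G | p.-elt x].

Lemma nilpotent_Sylow_p_elts gT (G : {group gT}) (p : nat) (P : {group gT}) :
  nilpotent G -> p.-Sylow(G) P -> P :=: p_elts G p.
Proof.
move=> nilG sylP; have P_O := nilpotent_Hall_pcore nilG sylP.
have nP : P <| G by rewrite P_O pcore_normal.
apply/setP=> x; rewrite inE; case Gx: (x \in G) => /=.
  exact: mem_normal_Hall sylP nP Gx.
by apply: contraFF Gx => /(subsetP (normal_sub nP)).
Qed.

Lemma Sylow_p_elts gT (G : {group gT}) (p : nat) (P : {group gT}) :
  p.-Sylow(G) P -> #|p_elts G p| = (#|G|`_p)%N -> P :=: p_elts G p.
Proof.
move=> sylP c; apply/eqP; rewrite eqEcard c (card_Hall sylP) leqnn andbT.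
apply/subsetP=> x Px; rewrite inE (subsetP (pHall_sub sylP)) //.
exact: mem_p_elt (pHall_pgroup sylP) Px.
Qed.

(** Each Sylow subgroup is then the set of all [p]-elements, hence normal and inside the Fitting
    subgroup; the Sylow subgroups generate [G]. *)
Lemma p_elts_nilpotent gT (G : {group gT}) :
  (forall p : nat, prime p -> #|p_elts G p| = (#|G|`_p)%N) -> nilpotent G.
Proof.
move=> c; suff <- : 'F(G) = G by apply: Fitting_nil.
apply/eqP; rewrite eqEsubset Fitting_sub -{1}(Sylow_gen G) gen_subG.
apply/bigcupsP=> P /SylowP[p pp sylP].
apply: Fitting_max (pgroup_nil (pHall_pgroup sylP)).
apply/andP; split; first exact: pHall_sub sylP.
apply/subsetP=> g Gg; rewrite inE (Sylow_p_elts sylP (c p pp)).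
apply/subsetP=> _ /imsetP[x /setIdP[Gx px] ->].
by rewrite inE groupJ // p_eltJ.
Qed.

Lemma constt_pcore gT (G : {group gT}) (pi : nat_pred) x :
  nilpotent G -> x \in G -> x.`_pi \in 'O_pi(G).
Proof.
move=> nilG Gx; rewrite (mem_normal_Hall (nilpotent_pcore_Hall pi nilG)) ?pcore_normal //.
  exact: p_elt_constt.
by rewrite groupX.
Qed.

(** Taking the [p]-constituent is the projection of the direct product of ['O_p(G)] and ['O_p^'(G)]
    onto its first factor. *)
Lemma constt_morph_nilpotent gT (G : {group gT}) (p : nat) :
  nilpotent G -> {in G &, {morph (fun x => x.`_p) : x y / x * y}}.
Proof.
move=> nilG x y Gx Gy /=.
have [_ _ cOO _] := dprodP (nilpotent_pcoreC p nilG).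
have com u v : u \in 'O_p(G) -> v \in 'O_p^'(G) -> commute u v.
  by move=> uO vO; apply/esym/(centsP cOO).
have Oxy : x.`_p * y.`_p \in 'O_p(G) by rewrite groupM ?constt_pcore.
have Oxy' : x.`_p^' * y.`_p^' \in 'O_p^'(G) by rewrite groupM ?constt_pcore.
have cyx : y.`_p * x.`_p^' = x.`_p^' * y.`_p by apply: com; apply: constt_pcore.
have -> : x * y = (x.`_p * y.`_p) * (x.`_p^' * y.`_p^').
  rewrite -{1}(consttC p x) -{1}(consttC p y) -!mulgA; congr (_ * _).
  by rewrite !mulgA cyx.
rewrite consttM; last exact: com Oxy Oxy'.
rewrite constt_p_elt ?(mem_p_elt (pcore_pgroup p G) Oxy) //.
by rewrite (constt1P (mem_p_elt (pcore_pgroup p^' G) Oxy')) mulg1.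
Qed.

Lemma mem_cycle_constt gT (x y : gT) :
  (forall p : nat, prime p -> y.`_p \in <[x.`_p]>) -> y \in <[x]>.
Proof.
move=> yx; apply: constt_cycle_mem => p pp.
by apply: mem_cycle_trans (yx p pp) _; apply: cycle_constt.
Qed.

Lemma constt_inj gT (x y : gT) :
  (forall p : nat, prime p -> x.`_p = y.`_p) -> x = y.
Proof.
move=> exy; have xy : <[x]> = <[y]>.
  apply/eqP; rewrite eqEsubset !cycle_subG.
  by rewrite !mem_cycle_constt // => p /exy ->; apply: cycle_id.
rewrite -[x]prod_constt -[y]prod_constt !orderE xy; apply: eq_bigr => p _.
have [pp|npp] := boolP (prime p); first exact: exy.
by rewrite !constt_eq1 //; rewrite (negPf npp).
Qed.

Lemma prod_pcore_constt gT (G : {group gT}) n (h : 'I_n -> gT) (j : 'I_n) :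
    nilpotent G -> (forall i : 'I_n, prime i -> h i \in 'O_i(G)) -> prime j ->
  (\prod_(i < n | prime i) h i).`_j = h j.
Proof.
move=> nilG hO pj; have hG (i : 'I_n) : prime i -> h i \in G.
  by move/hO; apply/subsetP/pcore_sub.
have -> : (\prod_(i < n | prime i) h i).`_j = \prod_(i < n | prime i) (h i).`_j.
  (* Membership of the partial products in [G] is carried along because the morphism property holds
     only there. *)
  apply: (proj1 (_ : _ /\ \prod_(i < n | prime i) h i \in G)).
  apply: (big_rec2 (fun u v => u.`_j = v /\ u \in G)) => [|i u v pi [<- Gv]].
    by rewrite constt1 group1.
  by rewrite (constt_morph_nilpotent _ nilG) ?groupM // hG.
rewrite big_mkcond (eq_bigr (fun i => if i == j then h j else 1)).
  by rewrite -big_mkcond big_pred1_eq.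
move=> i _; have [->|nij] := eqVneq i j.
  by rewrite pj constt_p_elt // (mem_p_elt (pcore_pgroup _ G) (hO j pj)).
case: ifP => // pi; apply: constt_prime_neq (mem_p_elt (pcore_pgroup _ G) (hO i pi)) _.
by rewrite eq_sym.
Qed.

Lemma eq_card_pparts gT hT (G : {group gT}) (H : {group hT}) :
  (forall p : nat, prime p -> (#|G|`_p)%N = (#|H|`_p)%N) -> #|G| = #|H|.
Proof.
move=> c; apply: eqn_from_log => // p.
have [pp|npp] := boolP (prime p); last first.
  by rewrite [LHS]lognE [RHS]lognE (negPf npp).
by have /eqP := c p pp; rewrite !p_part eqn_exp2l ?prime_gt1 // => /eqP.
Qed.

(** * Assembling isomorphisms over the primes, and the theorem *)

Lemma dpow_iso_pcores gT hT (G : {group gT}) (H : {group hT}) :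
    nilpotent G -> nilpotent H ->
    (forall p : nat, prime p -> exists f, dpow_iso 'O_p(G) 'O_p(H) f) ->
  exists f, dpow_iso G H f.
Proof.
move=> nilG nilH isoP; have cGH : #|G| = #|H|.
  apply: eq_card_pparts => p /isoP[f [inj im _]].
  rewrite -(card_Hall (nilpotent_pcore_Hall p nilG)).
  rewrite -(card_Hall (nilpotent_pcore_Hall p nilH)).
  by rewrite /= -im card_in_imset.
(* Elements of [G] and [H] have trivial [p]-constituent for every [p] above the common group order,
   so indices below [n] suffice. *)
pose n := #|G|.+1.
have /fin_all_exists[f fi] (i : 'I_n) : exists f, prime i -> dpow_iso 'O_i(G) 'O_i(H) f.
  have [/isoP[f fi]|npi] := boolP (prime i); first by exists f.
  by exists (fun=> 1).
pose F x := \prod_(i < n | prime i) f i x.`_i.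
have fO x : x \in G -> forall i : 'I_n, prime i -> f i x.`_i \in 'O_i(H).
  by move=> Gx i pi; have [_ <- _] := fi i pi; rewrite imset_f ?constt_pcore.
have FH x : x \in G -> F x \in H.
  by move=> Gx; apply: group_prod => i /(fO x Gx); apply/subsetP/pcore_sub.
have Fc x (i : 'I_n) : x \in G -> prime i -> (F x).`_i = f i x.`_i.
  by move=> Gx pi; rewrite (prod_pcore_constt nilH (fO x Gx)).
have big (rT : finGroupType) (K : {group rT}) z p : #|K| = #|G| -> z \in K ->
    n <= p -> z.`_p = 1.
  move=> cK Kz np; apply: constt_eq1 => pp pz.
  have := dvdn_leq (cardG_gt0 K) (dvdn_trans pz (order_dvdG Kz)).
  by rewrite cK leqNgt np.
have dir : {in G &, forall x y, (F y \in <[F x]>) = (y \in <[x]>)}.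
  move=> x y Gx Gy; apply/idP/idP => yx; apply: mem_cycle_constt => p pp.
    have [np|lt] := leqP n p; first by rewrite (big _ G) ?group1.
    have := constt_cycle p yx; have [_ _ d] := fi (Ordinal lt) pp.
    rewrite -[p]/(nat_of_ord (Ordinal lt)) !Fc // d ?constt_pcore //.
  have [np|lt] := leqP n p; first by rewrite (big _ H) ?group1 ?FH.
  have := constt_cycle p yx; have [_ _ d] := fi (Ordinal lt) pp.
  by rewrite -[p]/(nat_of_ord (Ordinal lt)) !Fc // d ?constt_pcore.
have inj : {in G &, injective F}.
  move=> x y Gx Gy exy; apply: constt_inj => p pp.
  have [np|lt] := leqP n p; first by rewrite !(big _ G).
  have := Fc x (Ordinal lt) Gx pp; rewrite exy Fc //= => e.
  have [injp _ _] := fi (Ordinal lt) pp.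
  by apply/esym/injp; rewrite ?constt_pcore.
exists F; split=> //; apply/eqP; rewrite eqEcard card_in_imset // cGH leqnn andbT.
by apply/subsetP=> _ /imsetP[x Gx ->]; apply: FH.
Qed.

Theorem theorem2 (gT hT : finGroupType) (G : {group gT}) (H : {group hT}) :
  nilpotent G ->
  (pow_graph_iso G H <->
   (nilpotent H /\
    forall p : nat, prime p ->
      forall (P : {group gT}) (Q : {group hT}),
        P \in 'Syl_p(G) -> Q \in 'Syl_p(H) -> pow_graph_iso P Q)).
Proof.
move=> nilG; split=> [/pow_graph_iso_dpow_iso[f fi]|[nilH isoP]].
  have [inj im dir] := fi.
  have cGH : #|G| = #|H| by rewrite -im card_in_imset.
  have elts (p : nat) : {in G, forall x, p.-elt (f x) = p.-elt x}.
    by move=> x Gx; rewrite /p_elt (dpow_iso_order fi).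
  (* Since [f] preserves orders, [H] has as many [p]-elements as [G]. This gives nilpotency of [H]
     and identifies its Sylow subgroups, to which [f] itself restricts. *)
  have cp (p : nat) : prime p -> #|p_elts H p| = (#|H|`_p)%N.
    move=> pp; rewrite -cGH -(card_setId inj im (elts p)).
    have sylG := nilpotent_pcore_Hall p nilG.
    by rewrite -(card_Hall sylG) (nilpotent_Sylow_p_elts nilG sylG).
  split=> [|p pp P Q]; first exact: p_elts_nilpotent.
  rewrite !inE => sylP sylQ; apply: (@dpow_iso_pow_graph_iso _ _ _ _ f).
  have PE := nilpotent_Sylow_p_elts nilG sylP.
  have sPG := subsetP (pHall_sub sylP).
  split; first by move=> x y /sPG Gx /sPG Gy; apply: inj.
    by rewrite PE (Sylow_p_elts sylQ (cp p pp)); apply: imset_setId im (elts p).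
  by move=> x y /sPG Gx /sPG Gy; apply: dir.
have [f fi] : exists f, dpow_iso G H f.
  apply: dpow_iso_pcores => // p pp; apply: pow_graph_iso_dpow_iso.
  by apply: (isoP p pp); rewrite inE nilpotent_pcore_Hall.
exact: dpow_iso_pow_graph_iso fi.
Qed.
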